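(* Let $\mathcal L$ be a set of $m$ distinct straight lines in $\mathbb R^3$, let $C\ge 1$, and let $\mathcal J_0$ be a finite set of points, each of which is an intersection point of the lines (i.e. lies on at least two distinct lines of $\mathcal L$). If $\mathcal J_0$ is proper 3-dimensional up to the constant factor $C$, then $$|\mathcal J_0|\le C^{3/2}m^{3/2}.$$
   Context: A set of $N$ points in $\mathbb R^3$ is called proper 3-dimensional up to a constant factor $C$ if it can be cut into singletons by at most $C\sqrt[3]{N}$ planes; that is, there is a set of at most $C\sqrt[3]{N}$ planes, none of which contains a point of the set, such that every open convex cell (connected component of the complement of the union of these planes) contains at most one point of the set. *)

(* Defs.v *)
From HB Require Import structures.
From mathcomp Require Import all_boot all_order all_algebra.
From mathcomp Require Import finmap.
From mathcomp Require Import all_classical all_reals all_analysis.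

Set Implicit Arguments.
Unset Strict Implicit.
Unset Printing Implicit Defensive.

Import Order.TTheory GRing.Theory Num.Theory.
Import numFieldNormedType.Exports.

Local Open Scope classical_set_scope.
Local Open Scope ring_scope.

Definition is_line (R : realType) (l : set 'rV[R]_3) : Prop :=
  exists p v : 'rV[R]_3, v != 0 /\ l = [set p + t *: v | t in [set: R]].

Definition is_plane (R : realType) (H : set 'rV[R]_3) : Prop :=
  exists (a : 'rV[R]_3) (c : R),
    a != 0 /\ H = [set x : 'rV[R]_3 | \sum_(i < 3) a 0 i * x 0 i = c].

(* [connected_component A x] is the empty set when [x] is not in [A], hence the
   restriction to points [x] of [A]. *)
Definition is_cell (R : realType) (P : {fset set 'rV[R]_3})
    (U : set 'rV[R]_3) : Prop :=
  let A := ~` \bigcup_(H in [set` P]) H in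
  exists2 x, A x & U = connected_component A x.

Definition proper_3dim (R : realType) (C : R) (S : {fset 'rV[R]_3}) : Prop :=
  exists P : {fset set 'rV[R]_3},
    [/\ forall H : set 'rV[R]_3, H \in P -> is_plane H,
        (#|` P|%:R <= C * (#|` S|%:R `^ 3^-1))%R,
        forall (H : set 'rV[R]_3) (x : 'rV[R]_3), H \in P -> x \in S -> ~ H x
      & forall U, is_cell P U ->
          forall x y : 'rV[R]_3, x \in S -> y \in S -> U x -> U y -> x = y].

Definition is_intersection_point (R : realType) (L : {fset set 'rV[R]_3})
    (x : 'rV[R]_3) : Prop :=
  exists l1 l2 : set 'rV[R]_3, [/\ l1 \in L, l2 \in L, l1 <> l2, l1 x & l2 x].

(* Main.v *)
(* No line through a point of [J0] lies in a cutting plane, so it meets each of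
   the k cutting planes at most once, and two of its points in [J0] are always
   separated by one of these crossings: a line carries at most k + 1 points.
   Every point lies on at least two lines, so 2 N <= m (k + 1) <= 2 m C N^(1/3),
   the last step because 1 <= C N^(1/3); hence N^(2/3) <= C m. *)
Require Import Defs.
From HB Require Import structures.
From mathcomp Require Import all_boot all_order all_algebra.
From mathcomp Require Import finmap ring lra.
From mathcomp Require Import all_classical all_reals all_analysis.

Set Implicit Arguments.
Unset Strict Implicit.
Unset Printing Implicit Defensive.

Import Order.TTheory GRing.Theory Num.Theory.
Import numFieldNormedType.Exports.

Local Open Scope classical_set_scope.
Local Open Scope ring_scope.

Local Notation line_pt p v t := (p + t *: v).

(** Along the line the linear form of the plane is affine in the parameter; taking the same value at
    two distinct parameters, it has slope zero. *)
Lemma plane_contains_line (R : realType) (H : set 'rV[R]_3) (p v : 'rV[R]_3)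
    (s t u : R) :
  is_plane H -> s != t -> H (line_pt p v s) -> H (line_pt p v t) ->
  H (line_pt p v u).
Proof.
move=> [a [c [_ ->]]] st /=.
have E r : \sum_(i < 3) a 0 i * (line_pt p v r) 0 i =
    \sum_(i < 3) a 0 i * p 0 i + r * \sum_(i < 3) a 0 i * v 0 i.
  rewrite mulr_sumr -big_split /=; apply: eq_bigr => i _; rewrite !mxE; ring.
rewrite !E => Es Et.
have : (s - t) * (\sum_(i < 3) a 0 i * v 0 i) = 0 by lra.
move/eqP; rewrite mulf_eq0 subr_eq0 (negbTE st) /= => /eqP av0.
by move: Es; rewrite av0 !mulr0.
Qed.

Lemma connected_segment_image (R : realType) (p v : 'rV[R]_3) (a b : R) :
  connected [set line_pt p v t | t in `[a, b]].
Proof.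
apply: connected_continuous_connected; first exact: segment_connected.
apply: continuous_subspaceT => t.
by apply: cvgD; [exact: cvg_cst | apply: cvgZl; exact: cvg_id].
Qed.

Section PlaneCut.
Variables (R : realType) (P : {fset set 'rV[R]_3}) (S : {fset 'rV[R]_3}).
Hypothesis planeP : forall H, H \in P -> is_plane H.
Hypothesis avoidP : forall H x, H \in P -> x \in S -> ~ H x.
Hypothesis cellP : forall U, is_cell P U ->
  forall x y, x \in S -> y \in S -> U x -> U y -> x = y.

(** If no plane met the segment, it would be a connected subset of the complement, so its two
    distinct endpoints would share a cell. *)
Lemma separating_plane (p v : 'rV[R]_3) (a b : R) :
  v != 0 -> a < b -> line_pt p v a \in S -> line_pt p v b \in S ->
  exists H t, [/\ H \in P, a < t < b & H (line_pt p v t)].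
Proof.
move=> v0 ab aS bS.
have [[H [t [HP tab Ht]]]|noH] :=
    pselect (exists H t, [/\ H \in P, a <= t <= b & H (line_pt p v t)]).
  (* The crossing is strictly inside, because the endpoints lie in [S], which the planes avoid. *)
  exists H, t; split => //; case/andP: tab => at_ tb.
  rewrite !lt_neqAle at_ tb !andbT; apply/andP.
  by split; apply/eqP => E; apply: (avoidP HP _ Ht); rewrite -?E // E.
pose A := ~` \bigcup_(H in [set` P]) H.
pose I := [set line_pt p v t | t in `[a, b]].
have IA : I `<=` A.
  by move=> _ [t tab <-] [H HP Ht]; apply: noH; exists H, t.
have Ia : I (line_pt p v a) by exists a => //=; rewrite in_itv /= lexx ltW.
have Ib : I (line_pt p v b) by exists b => //=; rewrite in_itv /= lexx ltW.
have IC : I `<=` connected_component A (line_pt p v a).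
  by apply: connected_component_max => //; exact: connected_segment_image.
have /eqP : line_pt p v a = line_pt p v b.
  apply: (@cellP (connected_component A (line_pt p v a))) => //.
  - by exists (line_pt p v a) => //; exact: IA.
  - exact: IC.
  - exact: IC.
rewrite (inj_eq (addrI p)) -subr_eq0 -scalerBl scaler_eq0 (negbTE v0) orbF.
by rewrite subr_eq0 (lt_eqF ab).
Qed.

(* The number of planes crossed before [x] strictly increases along the points
   of [S] on the line, hence takes distinct values in [0 .. #|P|] on them. *)
Lemma card_points_on_line (l : set 'rV[R]_3) :
  is_line l -> (#|` [fset x in S | x \in l]%fset| <= #|` P|.+1)%N.
Proof.
move=> [p [v [v0 lE]]].
pose before x := [fset H in P |
  `[< exists s t, [/\ x = line_pt p v t, s < t & H (line_pt p v s)] >]]%fset.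
(* Hence the [t] quantified in [before x] can only be the parameter of [x]. *)
have parI t u : line_pt p v t = line_pt p v u -> t = u.
  move/addrI/eqP; rewrite -subr_eq0 -scalerBl scaler_eq0 (negbTE v0) orbF.
  by rewrite subr_eq0 => /eqP.
have mono a b : a < b -> line_pt p v a \in S -> line_pt p v b \in S ->
    (#|` before (line_pt p v a)| < #|` before (line_pt p v b)|)%N.
  move=> ab aS bS; apply: fproper_ltn_card; rewrite fproperEneq andbC.
  apply/andP; split.
    apply/fsubsetP => H; rewrite !inE /= => /andP[->].
    move=> /asboolP[s [t [/parI <- sa Hs]]].
    by apply/asboolP; exists s, b; split => //; exact: lt_trans ab.
  (* Strictness: [H] is crossed before [b]. Were it also crossed at some [s < a], it would contain
     the whole line, including the point of [S] at [a]. *)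
  have [H [t [HP /andP[at_ tb] Ht]]] := separating_plane v0 ab aS bS.
  apply/eqP => /fsetP/(_ H); rewrite !inE /= HP /=.
  rewrite [RHS]asboolT; last by exists t, b.
  move/asboolP => -[s [u [/parI <- sa Hs]]].
  apply: (avoidP HP aS); apply: plane_contains_line Hs Ht; first exact: planeP.
  by rewrite lt_eqF // (lt_trans sa).
set F := [fset x in S | x \in l]%fset.
have inj : {in F &, injective (fun x => #|` before x|)}.
  move=> x y; rewrite !inE /= lE => /andP[xS /set_mem[a _ xE]].
  move=> /andP[yS /set_mem[b _ yE]]; subst x y => E.
  by have [ab|ab|->//] := ltgtP a b; have := mono _ _ ab; rewrite E ltnn;
    move=> /(_ _ _)/[!(xS, yS)] => /(_ isT isT).
rewrite -[X in (_ <= X)%N](size_iota 0) -(size_map (fun x => #|` before x|) F).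
apply: uniq_leq_size; first by rewrite map_inj_in_uniq ?fset_uniq.
move=> _ /mapP[x _ ->]; rewrite mem_iota /= add0n ltnS.
by apply: fsubset_leq_card; apply/fsubsetP => H; rewrite !inE => /andP[].
Qed.

End PlaneCut.

(** Double counting of the incidences between [S] and [L]: at least two per point, at most [k] per
    line. *)
Lemma card_intersection_points (R : realType) (L : {fset set 'rV[R]_3})
    (S : {fset 'rV[R]_3}) (k : nat) :
  (forall x, x \in S -> is_intersection_point L x) ->
  (forall l, l \in L -> (#|` [fset x in S | x \in l]%fset| <= k)%N) ->
  (2 * #|` S| <= #|` L| * k)%N.
Proof.
move=> hS hk.
have cardE (T : choiceType) (A : {fset T}) (Q : pred T) :
    #|` [fset x in A | Q x]%fset| = (\sum_(x <- A) Q x)%N.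
  by rewrite -sum1_size big_fset /= big_mkcond /=.
apply: (@leq_trans (\sum_(x <- S) \sum_(l <- L) (x \in l))%N).
  rewrite -sum1_size big_distrr /= muln1 big_seq [leqRHS]big_seq.
  apply: leq_sum => x /hS[l1 [l2 [l1L l2L l12 l1x l2x]]].
  rewrite -cardE; apply: (@leq_trans #|` [fset l1; l2]%fset|).
    by rewrite cardfs2; case: eqP.
  apply: fsubset_leq_card; apply/fsubsetP => l.
  by rewrite !inE => /orP[]/eqP-> /=; rewrite ?l1L ?l2L; exact: mem_set.
rewrite exchange_big /= -(sum1_size L) big_distrl /= mul1n.
rewrite big_seq [leqRHS]big_seq.
by apply: leq_sum => l lL; rewrite -cardE; exact: hk.
Qed.

Theorem theorem1p4 (R : realType) (m : nat) (L : {fset set 'rV[R]_3}) (C : R)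
    (J0 : {fset 'rV[R]_3})
    (hL : forall l : set 'rV[R]_3, l \in L -> is_line l)
    (hm : #|` L| = m)
    (hC : 1 <= C)
    (hJ0 : forall x : 'rV[R]_3, x \in J0 -> is_intersection_point L x)
    (hproper : proper_3dim C J0) :
  #|` J0|%:R <= C `^ (3 / 2) * m%:R `^ (3 / 2).
Proof.
case: hproper => P [planeP cardP avoidP cellP].
have := card_intersection_points hJ0
  (fun l lL => card_points_on_line planeP avoidP cellP (hL l lL)).
rewrite hm -(ler_nat R) !natrM => incidences.
(* The empty case is set apart because [1 <= r] below needs [1 <= N]. *)
have [->|N0] := eqVneq #|` J0| 0%N; first by rewrite mulr_ge0 // powR_ge0.
set N : R := #|` J0|%:R in cardP incidences *.
have N1 : 1 <= N by rewrite ler1n lt0n.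
have M0 : 0 <= m%:R :> R by [].
set r := N `^ 3^-1 in cardP.
have r1 : 1 <= r.
  have <- : 1 `^ 3^-1 = 1 :> R by rewrite powR1.
  by rewrite ge0_ler_powR ?nnegrE //; lra.
have rN : N = r * r ^+ 2.
  by rewrite -exprS -powR_mulrn ?powR_ge0 // -powRrM mulVf // powRr1 //; lra.
have r2 : r ^+ 2 <= C * m%:R.
  (* After multiplication by [2 * r] the left side is [2 * N], the incidence lower bound;
     [1 <= C * r] absorbs the [+ 1] on the right. *)
  rewrite -(ler_pM2l (_ : 0 < 2 * r)); last lra.
  have : 1 <= C * r by nra.
  rewrite -(natr1 #|` P|) in incidences => Cr.
  rewrite -mulrA -rN; apply: (le_trans incidences).
  have : m%:R * (#|` P|%:R + 1) <= m%:R * (2 * (C * r)).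
    by apply: ler_wpM2l => //; lra.
  by lra.
rewrite -powRM //; last lra.
(* The exponents multiply to 1/3 * 2 * 3/2 = 1, so raising [r2] to the power 3/2 concludes. *)
have -> : N = (r ^+ 2) `^ (3 / 2).
  by rewrite -powR_mulrn ?powR_ge0 // -!powRrM (_ : _ * _ = 1) ?powRr1 //;
    field.
by rewrite ge0_ler_powR ?nnegrE ?mulr_ge0 ?exprn_ge0 //; lra.
Qed.
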